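(* Let $w=w_1w_2\dots$ be an infinite, non ultimately periodic word on a finite alphabet $\mathcal{A}$ such that $\delta(w)<2$, let $\varphi:\mathcal{A}\to\mathbb{N}^*$ be injective, and let $\xi_{w,\varphi}$ be the real number with continued fraction expansion $\xi_{w,\varphi}=[0,\varphi(w_1),\varphi(w_2),\varphi(w_3),\dots]$. Then $\beta_0(\xi_{w,\varphi})=\delta(w)$.
   Context: For an infinite word $w$, let $(n_i)_{i\ge1}$ be the increasing sequence of all $n$ such that the prefix $w_1\dots w_n$ is a palindrome; $\delta(w)=\limsup n_{i+1}/n_i$ if this sequence is infinite and $+\infty$ otherwise. For real $\xi$ and $\underline{x}=(x_0,x_1,x_2)\in\mathbb{Z}^3$, $L(\underline{x})=\max(|x_0\xi-x_1|,|x_0\xi^2-x_2|)$. For $0<\varepsilon\le1$, $\beta_\varepsilon(\xi)$ is the infimum of all $\beta$ such that for every sufficiently large $B$ there is $\underline{x}\in\mathbb{Z}^3$ with $1\le|x_0|\le B$ and $L(\underline{x})\le\min(B^{-1/\beta},|x_0|^{\varepsilon-1})$ ($+\infty$ if none); $\beta_0(\xi)=\sup_{0<\varepsilon<1}\beta_\varepsilon(\xi)$. *)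

(* Defs.v *)
From HB Require Import structures.
From mathcomp Require Import all_boot all_order all_algebra.
From mathcomp Require Import all_classical all_reals all_analysis.
Set Implicit Arguments.
Unset Strict Implicit.
Unset Printing Implicit Defensive.
Import Order.TTheory GRing.Theory Num.Theory.
Import numFieldNormedType.Exports.
Local Open Scope classical_set_scope.
Local Open Scope ring_scope.

(* Infinite words are 0-indexed: [w i] is the letter $w_{i+1}$. *)

Definition ultimately_periodic (A : Type) (w : nat -> A) : Prop :=
  exists N p : nat, (0 < p)%N /\ forall n, (N <= n)%N -> w (n + p)%N = w n.

Definition pal_prefix (A : eqType) (w : nat -> A) (n : nat) : bool :=
  rev (mkseq w n) == mkseq w n.

Definition inf_many_pal_prefixes (A : eqType) (w : nat -> A) : Prop :=
  forall m, exists n, (m < n)%N && pal_prefix w n.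

(* [pal_length H i] is $n_{i+1}$: the empty prefix is not counted. *)
Definition pal_length (A : eqType) (w : nat -> A)
    (H : inf_many_pal_prefixes w) (i : nat) : nat :=
  iter i.+1 (fun m => ex_minn (H m)) 0%N.

Definition delta (R : realType) (A : eqType) (w : nat -> A) : \bar R :=
  match pselect (inf_many_pal_prefixes w) with
  | left H =>
      limn_esup (fun i => ((pal_length H i.+1)%:R / (pal_length H i)%:R)%:E)
  | right _ => +oo%E
  end.

Definition approx_L (R : realType) (xi : R) (x0 x1 x2 : int) : R :=
  Num.max `|x0%:~R * xi - x1%:~R| `|x0%:~R * xi ^+ 2 - x2%:~R|.

(* The exponents are positive: a negative one would satisfy the condition for
   trivial reasons (take [x0 = 1]), and the infimum would always be -oo. *)
Definition beta_exponent (R : realType) (eps xi b : R) : Prop :=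
  0 < b /\
  \forall B \near +oo, exists x0 x1 x2 : int,
    [/\ 1 <= `|x0%:~R : R|, `|x0%:~R : R| <= B &
      approx_L xi x0 x1 x2 <=
        Num.min (B `^ (- b^-1)) (`|x0%:~R : R| `^ (eps - 1))].

Definition beta (R : realType) (eps xi : R) : \bar R :=
  ereal_inf [set b%:E | b in beta_exponent eps xi].

Definition beta0 (R : realType) (xi : R) : \bar R :=
  ereal_sup [set beta eps xi | eps in [set e : R | 0 < e < 1]].

(* [cfrac [:: a_1; ...; a_n]] is $[0, a_1, \dots, a_n]$. *)
Definition cfrac (R : realType) (s : seq nat) : R :=
  foldr (fun a x => (a%:R + x)^-1) 0 s.

Definition cf_real (R : realType) (a : nat -> nat) : R :=
  limn (fun n => cfrac R (mkseq a n)).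

(* Main.v *)
Require Import Defs.
From HB Require Import structures.
From mathcomp Require Import all_boot all_order all_algebra.
From mathcomp Require Import all_classical all_reals all_analysis.
From mathcomp Require Import zify ring lra.
Import Order.TTheory GRing.Theory Num.Theory.
Import numFieldNormedType.Exports.
Set Implicit Arguments.
Unset Strict Implicit.
Unset Printing Implicit Defensive.

(** Let $a = \varphi \circ w$, let $p_n/q_n$ be the convergents of $\xi$ and let
    $N_0 < N_1 < \dots$ be the lengths of the palindromic prefixes of $w$. The
    matrix product attached to a palindromic prefix of length $n$ is symmetric,
    so $p_n = q_{n-1}$ and the point $y_i = (q_n, p_n, p_{n-1})$, $n = N_i$,
    satisfies $L(y_i) \asymp 1/Y_i$ with $Y_i = q_{N_i}$.

    Since $\delta(w) < 2$, each palindromic prefix occurs in every window of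
    twice its length. As $\log q$ is subadditive up to a constant, this forces
    $\log Y_i / N_i$ to converge to a positive limit, so
    $\limsup \log Y_{i+1} / \log Y_i = \delta(w)$. Approximating by the $y_i$
    gives $\beta_\varepsilon(\xi) \le \delta(w)$.

    Conversely, if $y_{i-1}, y_i, y_{i+1}$ are linearly dependent then the
    differences $N_{i+1} - N_i$ do not increase at $i$, hence neither do the
    ratios $N_{i+1} / N_i$; as $w$ is not ultimately periodic, $\delta(w)$ is
    also the upper limit over the indices where the three points are
    independent. For such an $i$ a point $x$ with $|x_0| \le B = Y_{i+1}/2$ and
    $L(x) \le B^{-1/\beta}$, $\beta < \delta(w)$, satisfies
    $\det(x, y_i, y_{i+1}) = 0$. If $|x_0|$ is small compared with
    $Y_{i-1} Y_i$, then also $\det(x, y_{i-1}, y_i) = 0$, so $x$ is a multiple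
    of $y_i$ and $L(x)$ is too large. Otherwise $L(x) \le |x_0|^{\varepsilon-1}$
    and $\delta(w)^2 - \delta(w) < 2$ give $\det(x, y_{i-1}, y_{i+1}) = 0$, so
    $x$ is a multiple of $y_{i+1}$ and $|x_0|$ is too large. *)

(** * Palindromic prefixes *)

Section PalindromicPrefixes.
Variables (T : eqType) (w : nat -> T).

Lemma pal_prefixP n :
  reflect (forall k, k < n -> w (n.-1 - k) = w k) (pal_prefix w n).
Proof.
apply: (iffP eqP) => [e k kn|e].
  have := congr1 (fun s => nth (w 0) s k) e.
  rewrite nth_rev ?size_mkseq // !nth_mkseq //; last by lia.
  by move=> <-; congr w; lia.
apply: (@eq_from_nth _ (w 0)) => [|k]; first by rewrite size_rev.
rewrite size_rev size_mkseq => kn.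
rewrite nth_rev ?size_mkseq // !nth_mkseq //; last by lia.
by rewrite -[RHS]e //; congr w; lia.
Qed.

(** Reflecting in the palindrome of length [n] and then in that of length [m] is the translation by
    [n - m]. *)
Lemma pal_prefix_shift m n k : pal_prefix w m -> pal_prefix w n -> m <= n ->
  k < m -> w (n - m + k) = w k.
Proof.
move=> /pal_prefixP pm /pal_prefixP pn mn km.
rewrite -(pn (n - m + k)) -?(pm k) //; last by lia.
by congr w; lia.
Qed.

Lemma pal_prefix_border m n : pal_prefix w n -> m <= n ->
  (forall k, k < m -> w (n - m + k) = w k) -> pal_prefix w m.
Proof.
move=> /pal_prefixP pn mn e; apply/pal_prefixP => k km.
rewrite -[RHS]e // -(pn (n - m + k)); last by lia.
by congr w; lia.
Qed.

Lemma mkseq_pal_shift m n : pal_prefix w m -> pal_prefix w n -> m <= n ->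
  mkseq w n = mkseq w (n - m) ++ mkseq w m.
Proof.
move=> pm pn mn; apply: (@eq_from_nth _ (w 0)) => [|k].
  by rewrite size_cat !size_mkseq subnK.
rewrite size_mkseq => kn; rewrite nth_mkseq // nth_cat size_mkseq.
case: ltnP => kd; [by rewrite nth_mkseq|rewrite nth_mkseq; last by lia].
rewrite -[RHS](@pal_prefix_shift m n) //; last by lia.
by congr w; lia.
Qed.

(** If [n2 - n1] exceeded [n1 - n0], commutation would make [n1 - n0] a period of the prefix of
    length [n2]; the border of length [n2 - (n1 - n0)] would be a palindrome strictly between [n1]
    and [n2]. *)
Lemma pal_prefix_commute n0 n1 n2 : n0 < n1 -> n1 < n2 ->
  pal_prefix w n0 -> pal_prefix w n1 -> pal_prefix w n2 ->
  (forall m, n1 < m -> m < n2 -> ~~ pal_prefix w m) ->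
  mkseq w (n2 - n1) ++ mkseq w (n1 - n0) =
    mkseq w (n1 - n0) ++ mkseq w (n2 - n1) ->
  n2 - n1 <= n1 - n0.
Proof.
move=> n01 n12 p0 p1 p2 gap com; rewrite leqNgt; apply/negP => lt.
have : ~~ pal_prefix w (n2 - (n1 - n0)) by apply: gap; lia.
move/negP; apply; apply: (@pal_prefix_border _ n2) => //; first by lia.
move=> k km; have -> : n2 - (n2 - (n1 - n0)) = n1 - n0 by lia.
have [kd|kd] := ltnP k (n2 - n1).
  have := congr1 (fun s => nth (w 0) s (n1 - n0 + k)) com.
  rewrite !nth_cat !size_mkseq [in RHS]ifN ?addKn; last by lia.
  rewrite [in RHS]nth_mkseq; last by lia.
  case: ltnP => le; first by rewrite nth_mkseq.
  rewrite nth_mkseq; last by lia.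
  by rewrite -(@pal_prefix_shift n1 n2) ?subnKC //; lia.
(* Here both letters are translates of the letter at [k - (n2 - n1)], by [n2 - n0] on the left and
   by [n2 - n1] on the right. *)
have -> : k = n2 - n1 + (k - (n2 - n1)) by lia.
rewrite (@pal_prefix_shift n1 n2) //; [|by lia|by lia].
rewrite -[RHS](@pal_prefix_shift n0 n2); [|by []|by []|by lia|by lia].
by congr w; lia.
Qed.

Variable N : nat -> nat.
Hypothesis N_inc : forall i, N i < N i.+1.
Hypothesis N_pal : forall i, pal_prefix w (N i).

Lemma increasing_leq i j : i <= j -> N i <= N j.
Proof.
elim: j => [|j IH]; first by rewrite leqn0 => /eqP ->.
rewrite leq_eqVlt ltnS => /orP[/eqP-> //|/IH le].
exact: leq_trans le (ltnW (N_inc j)).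
Qed.

Lemma increasing_ge_id i : i <= N i.
Proof. by elim: i => // i IH; apply: leq_ltn_trans IH (N_inc i). Qed.

(** Each palindromic prefix is covered by its predecessor and the suffix copy of it, so occurrences
    of the prefix of length [N i] propagate by induction with gaps at most [N i]. *)
Lemma pal_prefix_recurs i : (forall j, i <= j -> N j.+1 <= 2 * N j) ->
  forall k, exists2 t, k <= t <= k + N i &
    forall x, x < N i -> w (t + x) = w x.
Proof.
move=> N2 k.
have H j : i <= j -> forall k, k < N j - N i -> exists2 t,
    k < t <= k + N i & t + N i <= N j /\ forall x, x < N i -> w (t + x) = w x.
  elim: j => [|j IH] ij {}k kj.
    by move: ij kj; rewrite leqn0 => /eqP ->; rewrite subnn.
  have [ij'|] := ltnP i j.+1; last first.
    by move=> ji; have e : i = j.+1 by [lia]; move: kj; rewrite e subnn.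
  have {}ij' : i <= j by [].
  have Nij := increasing_leq ij'.
  have Nj := N_inc j.
  have [kj'|jk] := ltnP k (N j - N i).
    have [t tk [tN tw]] := IH ij' _ kj'.
    by exists t => //; split=> //; apply: leq_trans tN (ltnW (N_inc j)).
  (* [k] is beyond the reach of the first copy: the start of the suffix copy serves, and doubling
     keeps it within [k + N i]. *)
  have [kd|kd] := ltnP k (N j.+1 - N j).
    exists (N j.+1 - N j); first by have := N2 j ij'; lia.
    split=> [|x xN]; first by lia.
    by apply: pal_prefix_shift => //; lia.
  have [|t tk [tN tw]] := IH ij' (k - (N j.+1 - N j)); first by lia.
  exists (N j.+1 - N j + t); first by lia.
  split=> [|x xN]; first by lia.
  rewrite -addnA pal_prefix_shift //; [exact: tw|by lia|by lia].
have [||t tk [_ tw]] := H (k + N i).+1 _ k; last by exists t => //; lia.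
  by have := increasing_ge_id i; lia.
by have := increasing_ge_id (k + N i).+1; lia.
Qed.

(** The differences are positive integers that eventually do not increase, hence are eventually
    constant; the constant is a period of arbitrarily long palindromic prefixes, so of [w]. *)
Lemma concave_ultimately_periodic i0 :
  (forall i, i0 <= i -> N i.+2 - N i.+1 <= N i.+1 - N i) ->
  ultimately_periodic w.
Proof.
move=> conc.
have [i1 i01 dmin] : exists2 i1, i0 <= i1 &
    forall i, i0 <= i -> N i1.+1 - N i1 <= N i.+1 - N i.
  have H p : forall j, i0 <= j -> N j.+1 - N j <= p -> exists2 i1, i0 <= i1 &
      forall i, i0 <= i -> N i1.+1 - N i1 <= N i.+1 - N i.
    elim: p => [|p IH] j ij jp; first by have := N_inc j; lia.
    case: (pselect (exists2 j', i0 <= j' & N j'.+1 - N j' <= p)).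
      by move=> [j' ij' jp']; apply: IH ij' jp'.
    move=> no; exists j => // i ii; rewrite leqNgt; apply/negP => lt.
    by apply: no; exists i => //; lia.
  exact: (H _ i0).
have dE i : i1 <= i -> N i.+1 - N i = N i1.+1 - N i1.
  elim: i => [|i IH]; first by rewrite leqn0 => /eqP ->.
  rewrite leq_eqVlt ltnS => /orP[/eqP<- //|le].
  have := conc i; have := dmin i.+1; have := IH le; lia.
exists 0, (N i1.+1 - N i1); split; first by have := N_inc i1; lia.
move=> n _; have le : i1 <= i1 + n.+1 by lia.
rewrite addnC -(dE _ le) pal_prefix_shift //; first exact: ltnW.
by have := increasing_ge_id (i1 + n.+1); lia.
Qed.

End PalindromicPrefixes.

Local Open Scope classical_set_scope.
Local Open Scope ring_scope.

(** * Products of continued fraction matrices *)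

Lemma mulmx22E (R : comNzRingType) (M N : 'M[R]_2) i j :
  (M * N) i j = M i 0 * N 0 j + M i 1 * N 1 j.
Proof.
rewrite -mulmxE mxE big_ord_recl big_ord1; congr (_ + M i _ * N _ j);
  exact: val_inj.
Qed.

Lemma eq_mx22 (R : Type) (M N : 'M[R]_2) :
  M 0 0 = N 0 0 -> M 0 1 = N 0 1 -> M 1 0 = N 1 0 -> M 1 1 = N 1 1 -> M = N.
Proof.
have ordE (i : 'I_2) : i = 0 \/ i = 1.
  by case: i => [[|[|m]]] p //; [left|right]; apply: val_inj.
move=> h1 h2 h3 h4; apply/matrixP => i j.
by case: (ordE i) => ->; case: (ordE j) => ->.
Qed.

Lemma det_mx22 (R : comNzRingType) (M : 'M[R]_2) :
  \det M = M 0 0 * M 1 1 - M 0 1 * M 1 0.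
Proof.
rewrite (expand_det_row _ 0) big_ord_recl big_ord1 /cofactor !det_mx11 !mxE.
rewrite /= ?expr0 ?expr1 mul1r mulN1r mulrN.
by congr (_ * M _ _ - M _ _ * M _ _); exact: val_inj.
Qed.

(** * Determinants of triples of symmetric matrices *)

Definition det3 (R : comNzRingType) (x y z : R * R * R) : R :=
  x.1.1 * (y.1.2 * z.2 - y.2 * z.1.2) - x.1.2 * (y.1.1 * z.2 - y.2 * z.1.1)
  + x.2 * (y.1.1 * z.1.2 - y.1.2 * z.1.1).

Definition sympoint (R : Type) (M : 'M[R]_2) : R * R * R :=
  (M 0 0, M 0 1, M 1 1).

Definition adj22 (R : comNzRingType) (M : 'M[R]_2) : 'M[R]_2 :=
  \matrix_(i, j) (if i == 0 then if j == 0 then M 1 1 else - M 0 1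
                  else if j == 0 then - M 1 0 else M 0 0).

Lemma mulmx_adj22 (R : comNzRingType) (M : 'M[R]_2) :
  M * adj22 M = (\det M)%:M.
Proof.
by apply: eq_mx22; rewrite mulmx22E !mxE /= det_mx22 ?mulr1n ?mulr0n; ring.
Qed.

(** Transposition exchanges the two sides, so their difference is antisymmetric; its only free entry
    is, up to sign, the determinant. *)
Lemma sym_adj22_det3 (R : comNzRingType) (A B C : 'M[R]_2) :
  A 1 0 = A 0 1 -> B 1 0 = B 0 1 -> C 1 0 = C 0 1 ->
  det3 (sympoint A) (sympoint B) (sympoint C) = 0 ->
  C * adj22 A * B = B * adj22 A * C.
Proof.
move=> hA hB hC; rewrite /det3 /sympoint /= => h0.
apply: eq_mx22; rewrite !mulmx22E !mxE /= ?hA ?hB ?hC; try ring.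
  apply/eqP; rewrite -subr_eq0 -[X in _ == X]oppr0 -[X in _ == - X]h0.
  by apply/eqP; ring.
by apply/eqP; rewrite -subr_eq0 -[X in _ == X]h0; apply/eqP; ring.
Qed.

(** In the identity for [M], [V * M], [U * (V * M)] the product [M * adj22 M] is the scalar
    [\det M], which cancels. *)
Lemma det3_eq0_commute (U V M : 'M[int]_2) : \det M != 0 ->
  M 1 0 = M 0 1 -> (V * M) 1 0 = (V * M) 0 1 ->
  (U * (V * M)) 1 0 = (U * (V * M)) 0 1 ->
  det3 (sympoint M) (sympoint (V * M)) (sympoint (U * (V * M))) = 0 ->
  U * (V * (V * M)) = V * (U * (V * M)).
Proof.
move=> M0 sM sV sU h0.
have e := sym_adj22_det3 sM sV sU h0.
have detI (A B : 'M[int]_2) : \det M *: A = \det M *: B -> A = B.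
  move=> /matrixP AB; apply/matrixP => i j.
  by have := AB i j; rewrite !mxE => /(mulfI M0).
apply: detI; move: e; rewrite -!mulrA (mulrA M) mulmx_adj22 (mulrA M) mulmx_adj22.
by rewrite -!mulmxE !mul_scalar_mx -!scalemxAr.
Qed.

(** * The matrix of a finite word of partial quotients *)

Definition cfmx (a : nat) : 'M[int]_2 :=
  \matrix_(i, j) (if i == 0 then if j == 0 then a%:Z else 1 else (j == 0)%:Z).

(** The rows are $(q_n, q_{n-1})$ and $(p_n, p_{n-1})$ for the convergents $p_k/q_k$ of
    $[0, a_1, \dots, a_n]$. *)
Definition cfprod (s : seq nat) : 'M[int]_2 := \prod_(a <- s) cfmx a.

Lemma cfprod_cat s t : cfprod (s ++ t) = cfprod s * cfprod t.
Proof. by rewrite /cfprod big_cat. Qed.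

Lemma cfprod_consE a s :
  ((cfprod (a :: s) 0 0 = a%:Z * cfprod s 0 0 + cfprod s 1 0) *
   (cfprod (a :: s) 0 1 = a%:Z * cfprod s 0 1 + cfprod s 1 1) *
   (cfprod (a :: s) 1 0 = cfprod s 0 0) * (cfprod (a :: s) 1 1 = cfprod s 0 1)).
Proof.
by rewrite /cfprod !big_cons !mulmx22E !mxE /= !mul1r !mul0r !addr0.
Qed.

Lemma cfprod_rconsE s a :
  ((cfprod (rcons s a) 0 0 = cfprod s 0 0 * a%:Z + cfprod s 0 1) *
   (cfprod (rcons s a) 1 0 = cfprod s 1 0 * a%:Z + cfprod s 1 1) *
   (cfprod (rcons s a) 0 1 = cfprod s 0 0) *
   (cfprod (rcons s a) 1 1 = cfprod s 1 0)).
Proof.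
rewrite -cats1 cfprod_cat !mulmx22E /cfprod !big_seq1 !mxE /=.
by rewrite !mulr1 !mulr0 !addr0.
Qed.

Lemma cfprod_nilE : ((cfprod [::] 0 0 = 1) * (cfprod [::] 0 1 = 0) *
  (cfprod [::] 1 0 = 0) * (cfprod [::] 1 1 = 1)).
Proof. by rewrite /cfprod !big_nil !mxE. Qed.

(** Each factor is symmetric, so reversing the word transposes the product. *)
Lemma cfprod_rev s :
  ((cfprod (rev s) 0 0 = cfprod s 0 0) * (cfprod (rev s) 0 1 = cfprod s 1 0) *
   (cfprod (rev s) 1 0 = cfprod s 0 1) * (cfprod (rev s) 1 1 = cfprod s 1 1)).
Proof.
elim: s => [|a s IH]; first by rewrite !cfprod_nilE.
by rewrite rev_cons !cfprod_rconsE !cfprod_consE !IH ![_ * a%:Z]mulrC.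
Qed.

Lemma det_cfprod s : \det (cfprod s) = (-1) ^+ size s.
Proof.
elim: s => [|a s IH]; first by rewrite det_mx22 !cfprod_nilE.
by move: IH; rewrite /= exprS !det_mx22 !cfprod_consE => <-; ring.
Qed.

Definition positive_word (s : seq nat) := all (fun a => 0 < a)%N s.

Lemma cfprod_bounds s : positive_word s ->
  [/\ 1 <= cfprod s 0 0, 0 <= cfprod s 0 1,
      0 <= cfprod s 1 0 <= cfprod s 0 0 & 0 <= cfprod s 1 1].
Proof.
elim: s => [_|a s IH /= /andP[a0 /IH[h1 h2 h3 h4]]]; first by rewrite !cfprod_nilE.
rewrite !cfprod_consE.
have a1 : 1 <= a%:Z by lia.
split; nia.
Qed.

Lemma cfprod01_le s : positive_word s -> cfprod s 0 1 <= cfprod s 0 0.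
Proof.
rewrite /positive_word -all_rev => /cfprod_bounds[_ _ /andP[_ h] _].
by move: h; rewrite !cfprod_rev.
Qed.

Lemma cfprod00_cat_le s t : positive_word s -> positive_word t ->
  cfprod (s ++ t) 0 0 <= 2 * (cfprod s 0 0 * cfprod t 0 0).
Proof.
move=> ps pt; rewrite cfprod_cat mulmx22E.
have [s1 s2 _ _] := cfprod_bounds ps.
have [t1 _ /andP[t2 t3] _] := cfprod_bounds pt.
have s3 := cfprod01_le ps.
by rewrite mulr_natl mulr2n lerD2l; apply: ler_pM.
Qed.

(** The first column determines the first letter: in $aq + r = bq + r'$ the remainders are both zero
    or both in $[1, q]$ because the sizes agree, so $|r - r'| < q$. *)
Lemma cfprod_inj s t : positive_word s -> positive_word t -> size s = size t ->
  cfprod s = cfprod t -> s = t.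
Proof.
elim: s t => [|a s IH] [|b t] //= /andP[a0 ps] /andP[b0 pt] [st] e.
have eE i j : cfprod (a :: s) i j = cfprod (b :: t) i j by rewrite e.
have := (eE 0 0, eE 0 1, eE 1 0, eE 1 1).
rewrite !cfprod_consE => -[[[e1 e2] e3] e4].
have ab : a = b.
  case: s t ps pt st e1 e2 e3 e4 {IH e eE} => [|c s] [|d t] //=.
    by rewrite !cfprod_nilE => _ _ _; lia.
  move=> /andP[c0 /cfprod_bounds[s1 s2 s3 _]].
  move=> /andP[d0 /cfprod_bounds[t1 t2 t3 _]] _.
  rewrite !cfprod_consE => e1 _ e3 _.
  move: e1; rewrite -e3; set q := _ + _ in e3 * => e1.
  have c1 : 1 <= c%:Z by lia.
  have d1 : 1 <= d%:Z by lia.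
  have qs : cfprod s 0 0 <= q by rewrite /q; nia.
  have qt : cfprod t 0 0 <= q by rewrite e3; nia.
  have e1' : (a%:Z - b%:Z) * q = cfprod t 0 0 - cfprod s 0 0.
    by rewrite mulrBl; lia.
  have [lt|lt|//] := ltngtP a b; nia.
rewrite -ab in e1 e2 *; congr (_ :: _); apply: IH => //.
apply: eq_mx22 => //; lia.
Qed.

(** * Convergents *)

Lemma cfrac_cfprod (R : realType) s : positive_word s ->
  cfrac R s = (cfprod s 1 0)%:~R / (cfprod s 0 0)%:~R.
Proof.
elim: s => [_|a s IH /= /andP[a0 ps]]; first by rewrite !cfprod_nilE mul0r.
rewrite [cfrac R _]/= IH // !cfprod_consE.
have [s1 _ _ _] := cfprod_bounds ps.
have q0 : (cfprod s 0 0)%:~R != 0 :> R by rewrite intr_eq0; lia.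
rewrite -{1}[a%:R](mulfK q0) -mulrDl invf_div; congr (_ / _).
by rewrite intrD intrM.
Qed.

Section ContinuedFraction.
Variables (a : nat -> nat).
Hypothesis a_pos : forall i, (0 < a i)%N.

Definition qcf n := cfprod (mkseq a n) 0 0.
Definition pcf n := cfprod (mkseq a n) 1 0.

Lemma positive_mkseq n : positive_word (mkseq a n).
Proof. by apply/allP => _ /mapP[k _ ->]. Qed.

Lemma cfprod_mkseqS n :
  ((cfprod (mkseq a n.+1) 0 1 = qcf n) * (cfprod (mkseq a n.+1) 1 1 = pcf n)).
Proof. by rewrite mkseqS !cfprod_rconsE. Qed.

Lemma qcfSS n : qcf n.+2 = qcf n.+1 * (a n.+1)%:Z + qcf n.
Proof. by rewrite /qcf (mkseqS _ n.+1) cfprod_rconsE cfprod_mkseqS. Qed.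

Lemma pcfSS n : pcf n.+2 = pcf n.+1 * (a n.+1)%:Z + pcf n.
Proof. by rewrite /pcf (mkseqS _ n.+1) cfprod_rconsE cfprod_mkseqS. Qed.

Lemma qcf0 : qcf 0 = 1. Proof. by rewrite /qcf cfprod_nilE. Qed.
Lemma pcf0 : pcf 0 = 0. Proof. by rewrite /pcf cfprod_nilE. Qed.
Lemma qcf1 : qcf 1 = a 0.
Proof. by rewrite /qcf cfprod_consE !cfprod_nilE mulr1 addr0. Qed.

Lemma qcf_ge1 n : 1 <= qcf n.
Proof. by have [] := cfprod_bounds (positive_mkseq n). Qed.

Lemma qcf_leS n : qcf n <= qcf n.+1.
Proof.
have := cfprod01_le (positive_mkseq n.+1).
by rewrite cfprod_mkseqS.
Qed.

Lemma qcf_mono m n : (m <= n)%N -> qcf m <= qcf n.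
Proof.
elim: n => [|n IH]; first by rewrite leqn0 => /eqP ->.
rewrite leq_eqVlt ltnS => /orP[/eqP-> //|/IH le].
exact: le_trans le (qcf_leS n).
Qed.

Lemma qcfSS_ge n : qcf n.+1 + qcf n <= qcf n.+2.
Proof.
rewrite qcfSS lerD2r ler_peMr //; last by have := a_pos n.+1; lia.
by have := qcf_ge1 n.+1; lia.
Qed.

Lemma qcf_ge n : n%:Z <= qcf n.
Proof.
suff : n%:Z <= qcf n /\ n.+1%:Z <= qcf n.+1 by case.
elim: n => [|n [h1 h2]]; first by rewrite qcf0 qcf1; have := a_pos 0; lia.
split=> //; have := qcfSS_ge n; have := qcf_ge1 n; lia.
Qed.

(** Denominators at least double every two steps. This later makes the density of their logarithms
    positive. *)
Lemma qcf_expo n : 2 ^+ n <= 2 * qcf n ^+ 2.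
Proof.
suff : 2 ^+ n <= 2 * qcf n ^+ 2 /\ 2 ^+ n.+1 <= 2 * qcf n.+1 ^+ 2 by case.
elim: n => [|n [h1 h2]].
  by rewrite qcf0 qcf1; have := a_pos 0; split => //; nia.
split=> //; have := qcfSS_ge n; have := qcf_leS n; have := qcf_ge1 n.
by move: h1; rewrite !exprS expr0 !mulr1; nia.
Qed.

Lemma qcfS_le C n : (forall i, a i <= C)%N -> qcf n.+1 <= C.+1%:Z * qcf n.
Proof.
move=> aC; case: n => [|n].
  by rewrite qcf0 qcf1 mulr1; have := aC 0%N; lia.
rewrite qcfSS; have := aC n.+1; have := qcf_leS n; have := qcf_ge1 n; nia.
Qed.

(** In [m], [D] obeys the recurrence of the denominators with values 0 at [n] and 1 at [n.+1], and
    the bounds pass along it. [D] over [qcf m] is $|q_n \xi_m - p_n|$ for the [m]-th convergent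
    $\xi_m$. *)
Lemma cross_convergents n m : (n <= m)%N ->
  let D := (-1) ^+ n * (qcf n * pcf m - pcf n * qcf m) in
  [/\ 0 <= D, D * qcf n.+1 <= qcf m &
      (n < m)%N -> qcf m <= D * (qcf n + qcf n.+1)].
Proof.
pose D m := (-1) ^+ n * (qcf n * pcf m - pcf n * qcf m).
have DSS k : D k.+2 = D k.+1 * (a k.+1)%:Z + D k.
  by rewrite /D qcfSS pcfSS; ring.
have Dn : D n = 0 by rewrite /D; ring.
have Dn1 : D n.+1 = 1.
  transitivity ((-1) ^+ n * \det (cfprod (mkseq a n))); last first.
    by rewrite det_cfprod size_mkseq -exprMn mulrNN mulr1 expr1n.
  rewrite det_mx22 /D /qcf /pcf !mkseqS !cfprod_rconsE; ring.
pose P m := [/\ 0 <= D m, D m * qcf n.+1 <= qcf m &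
      (n < m)%N -> 1 <= D m /\ qcf m <= D m * (qcf n + qcf n.+1)].
have q1 := qcf_ge1 n; have q2 := qcf_leS n.
suff H k : P (n + k)%N /\ P (n + k).+1.
  move=> nm; have [[h1 h2 h3] _] := H (m - n)%N.
  by move: h1 h2 h3; rewrite subnKC // => h1 h2 h3; split=> // /h3[].
elim: k => [|k [[h1 h2 h3] [g1 g2 g3]]].
  rewrite addn0 /P Dn Dn1 ltnn; split; split; try lia; nia.
rewrite addnS; split; first by split.
have [g4 g5] := g3 (leq_addr _ _).
have a1 : 1 <= (a (n + k).+1)%:Z by have := a_pos (n + k).+1; lia.
rewrite /P DSS qcfSS; split=> [||_]; [nia|rewrite mulrDl; nia|split; first nia].
(* The lower bound fails at $m = n$, where [D] vanishes, so $m = n + 2$ is checked from the initial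
   values. *)
rewrite [leRHS]mulrDl; case: k h1 h2 h3 g1 g2 g3 g4 g5 a1 => [|k].
  rewrite addn0 Dn Dn1 => *; nia.
rewrite addnS => h1 h2 h3; have [|h4 h5] := h3; first by rewrite ltnS leq_addr.
move=> *; nia.
Qed.

Section Approximation.
Variable R : realType.
Local Notation q n := ((qcf n)%:~R : R).
Local Notation p n := ((pcf n)%:~R : R).

Lemma qcf_gt0 n : 0 < q n.
Proof. by rewrite ltr0z; have := qcf_ge1 n; lia. Qed.

Lemma convergent_bounds n m : (n < m)%N ->
  (q n + q n.+1)^-1 <= `|q n * cfrac R (mkseq a m) - p n| <= (q n.+1)^-1.
Proof.
move=> nm; have [] := cross_convergents (ltnW nm).
set D := (X in 0 <= X) => D0 D1 /(_ nm) D2.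
rewrite cfrac_cfprod ?positive_mkseq // -/(pcf m) -/(qcf m).
have qm := qcf_gt0 m.
have -> : q n * (p m / q m) - p n = (-1) ^+ n * (D%:~R / q m).
  have -> : D%:~R = (-1) ^+ n * (q n * p m - p n * q m) :> R.
    by rewrite /D intrM intrB !intrM rmorphXn rmorphN.
  rewrite [RHS]mulrA [X in _ = X / _]mulrA -exprMn mulrNN mulr1 expr1n mul1r.
  by rewrite mulrBl mulrA mulfK // gt_eqF.
rewrite normrM normrX normrN1 expr1n mul1r ger0_norm; last first.
  by apply: divr_ge0; [rewrite ler0z|exact: ltW].
have qn := qcf_gt0 n; have qn1 := qcf_gt0 n.+1.
apply/andP; split.
  rewrite ler_pdivlMr // mulrC ler_pdivrMr ?addr_gt0 //.
  by rewrite -intrD -intrM ler_int.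
rewrite ler_pdivrMr // mulrC ler_pdivlMr // -intrM ler_int.
exact: D1.
Qed.

Lemma cfrac_cvg : cvgn (fun n => cfrac R (mkseq a n)).
Proof.
apply: cauchy_cvg; apply/cauchyP => e e0.
have [n ne] : exists n : nat, e^-1 < n.+1%:R.
  by exists (Num.truncn e^-1); rewrite truncnS_gt.
exists (cfrac R (mkseq a n)).
suff : \forall m \near \oo, ball (cfrac R (mkseq a n)) e (cfrac R (mkseq a m)).
  by [].
apply: filterS (nbhs_infty_ge n.+1) => m nm; rewrite -ball_normE /=.
have /andP[_] := convergent_bounds nm.
have qn := qcf_gt0 n; have qn0 : q n != 0 by rewrite gt_eqF.
have pE : p n = q n * cfrac R (mkseq a n).
  by rewrite cfrac_cfprod ?positive_mkseq // mulrCA mulfV // mulr1.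
rewrite pE -mulrBr normrM distrC gtr0_norm // => h.
apply: (@le_lt_trans _ _ n.+1%:R^-1); last first.
  by rewrite invf_plt ?posrE ?ltr0n.
apply: (@le_trans _ _ (q n.+1)^-1); last first.
  rewrite lef_pV2 ?posrE ?ltr0n ?qcf_gt0 // -[n.+1%:R]/(n.+1%:Z%:~R).
  by rewrite ler_int qcf_ge.
apply: le_trans h; rewrite ler_peMl // ler1z; exact: qcf_ge1.
Qed.

Lemma cf_real_bounds n :
  (q n + q n.+1)^-1 <= `|q n * cf_real R a - p n| <= (q n.+1)^-1.
Proof.
have cv : `|q n * cfrac R (mkseq a m) - p n| @[m --> \oo] -->
    `|q n * cf_real R a - p n|.
  apply: cvg_norm; apply: cvgB; last exact: cvg_cst.
  by apply: cvgMr; exact: cfrac_cvg.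
apply/andP; split.
  apply: (cvgr_to_ge cv); apply: filterS (nbhs_infty_ge n.+1) => m.
  by move/convergent_bounds => /andP[].
apply: (cvgr_to_le cv); apply: filterS (nbhs_infty_ge n.+1) => m.
by move/convergent_bounds => /andP[].
Qed.

End Approximation.

End ContinuedFraction.

(** * Points attached to palindromic prefixes *)

(** By Cramer, $\det(a,b,c)\,x = \det(a,x,c)\,b$. Pairing with [b], where $b_0b_2 - b_1^2 = \pm 1$,
    shows that $\det(a,b,c)$ divides $\det(a,x,c)$, so the factor is an integer. *)
Lemma det3_proportional (a b c x : int * int * int) :
  det3 a b c != 0 -> `|b.1.1 * b.2 - b.1.2 ^+ 2| = 1 ->
  det3 x b c = 0 -> det3 x a b = 0 ->
  exists k, x = (k * b.1.1, k * b.1.2, k * b.2).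
Proof.
move=> D0 bs xbc xab; set s := b.1.1 * b.2 - b.1.2 ^+ 2 in bs.
have ss : s * s = 1 by rewrite -expr2 -(real_normK (num_real s)) bs.
have E1 : det3 a b c * x.1.1 = det3 a x c * b.1.1.
  rewrite -[RHS]addr0 -(mul0r a.1.1) -xbc -[RHS]addr0 -(mul0r c.1.1) -xab /det3.
  by ring.
have E2 : det3 a b c * x.1.2 = det3 a x c * b.1.2.
  rewrite -[RHS]addr0 -(mul0r a.1.2) -xbc -[RHS]addr0 -(mul0r c.1.2) -xab /det3.
  by ring.
have E3 : det3 a b c * x.2 = det3 a x c * b.2.
  rewrite -[RHS]addr0 -(mul0r a.2) -xbc -[RHS]addr0 -(mul0r c.2) -xab /det3.
  by ring.
have E4 : det3 a b c * (s * (x.1.1 * b.2 - x.1.2 * b.1.2)) = det3 a x c.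
  rewrite -[RHS]mulr1 -ss {2}/s.
  transitivity (s * (det3 a b c * x.1.1 * b.2 - det3 a b c * x.1.2 * b.1.2)).
    by ring.
  by rewrite E1 E2; ring.
exists (s * (x.1.1 * b.2 - x.1.2 * b.1.2)).
have fin (u v : int) : det3 a b c * u = det3 a x c * v ->
    u = s * (x.1.1 * b.2 - x.1.2 * b.1.2) * v.
  by rewrite -E4 -mulrA => /(mulfI D0).
rewrite -(fin _ _ E1) -(fin _ _ E2) -(fin _ _ E3).
by case: x {xbc xab E1 E2 E3 E4 fin} => [[]].
Qed.

(** * Small determinants of approximation points *)

Section Heights.
Variables (R : realType) (xi : R).

Definition Lpt (x : int * int * int) : R := approx_L xi x.1.1 x.1.2 x.2.

Lemma LptP x c : (Lpt x <= c) = (`|x.1.1%:~R * xi - x.1.2%:~R| <= c) &&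
  (`|x.1.1%:~R * xi ^+ 2 - x.2%:~R| <= c).
Proof. by rewrite /Lpt /approx_L ge_max. Qed.

Lemma Lpt_ge0 x : 0 <= Lpt x.
Proof. by rewrite /Lpt /approx_L le_max normr_ge0. Qed.

Lemma Lpt_scale k (y : int * int * int) :
  Lpt (k * y.1.1, k * y.1.2, k * y.2) = `|k%:~R| * Lpt y.
Proof.
rewrite /Lpt /approx_L /= !intrM maxr_pMr ?normr_ge0 // -!normrM.
by rewrite !mulrBr !mulrA.
Qed.

(** Column operations replace $x_1$, $x_2$ by $x_0\xi - x_1$, $x_0\xi^2 - x_2$ up to sign; each
    minor of these columns is at most twice a product of two values of [Lpt]. *)
Lemma det3_le x y z :
  `|(det3 x y z)%:~R| <= 2 * (`|x.1.1%:~R| * Lpt y * Lpt z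
    + `|y.1.1%:~R| * Lpt x * Lpt z + `|z.1.1%:~R| * Lpt x * Lpt y).
Proof.
pose e1 (x : int * int * int) : R := x.1.1%:~R * xi - x.1.2%:~R.
pose e2 (x : int * int * int) : R := x.1.1%:~R * xi ^+ 2 - x.2%:~R.
have le1 u : `|e1 u| <= Lpt u by have := lexx (Lpt u); rewrite LptP => /andP[].
have le2 u : `|e2 u| <= Lpt u by have := lexx (Lpt u); rewrite LptP => /andP[].
have minor u v : `|e1 u * e2 v - e2 u * e1 v| <= 2 * (Lpt u * Lpt v).
  rewrite mulr_natl mulr2n; apply: le_trans (ler_normB _ _) _.
  by rewrite !normrM lerD // ler_pM.
have -> : (det3 x y z)%:~R = x.1.1%:~R * (e1 y * e2 z - e2 y * e1 z)
   - y.1.1%:~R * (e1 x * e2 z - e2 x * e1 z)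
   + z.1.1%:~R * (e1 x * e2 y - e2 x * e1 y) :> R.
  rewrite /det3 /e1 /e2 !(intrD, intrM, intrN) /=.
  by ring.
apply: le_trans (ler_normD _ _) _; rewrite [leRHS]mulrDr lerD //; last first.
  by rewrite normrM -mulrA mulrCA; apply: ler_pM.
apply: le_trans (ler_normB _ _) _; rewrite [leRHS]mulrDr lerD //.
  by rewrite normrM -mulrA mulrCA; apply: ler_pM.
by rewrite normrM -mulrA mulrCA; apply: ler_pM.
Qed.

Lemma det3_eq0 x y z :
  2 * (`|x.1.1%:~R| * Lpt y * Lpt z
    + `|y.1.1%:~R| * Lpt x * Lpt z + `|z.1.1%:~R| * Lpt x * Lpt y) < 1 ->
  det3 x y z = 0.
Proof.
move=> /(le_lt_trans (det3_le x y z)).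
rewrite -intr_norm -[1]/(1%:~R) ltr_int; lia.
Qed.

End Heights.

Section PalindromicPoints.
Variable a : nat -> nat.
Hypothesis a_pos : forall i, (0 < a i)%N.

Definition palpt n := sympoint (cfprod (mkseq a n)).

Lemma pal_cfprod_sym n : pal_prefix a n ->
  cfprod (mkseq a n) 1 0 = cfprod (mkseq a n) 0 1.
Proof. by move=> /eqP pn; rewrite -{1}pn cfprod_rev. Qed.

Lemma palpt_unimodular n : pal_prefix a n ->
  `|(palpt n).1.1 * (palpt n).2 - (palpt n).1.2 ^+ 2| = 1.
Proof.
move=> pn; have := det_cfprod (mkseq a n).
rewrite det_mx22 (pal_cfprod_sym pn) -expr2 /palpt /sympoint /= => ->.
by rewrite normrX normrN1 expr1n.
Qed.

(** With [M], [V], [U] the matrices of the prefixes of lengths [n0], [n1 - n0], [n2 - n1], the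
    points come from [M], [V * M], [U * (V * M)]. Dependence gives $UVVM = VUVM$, which injectivity
    of [cfprod] turns into an equality of words. *)
Lemma palpt_dependent n0 n1 n2 : (n0 < n1)%N -> (n1 < n2)%N ->
  pal_prefix a n0 -> pal_prefix a n1 -> pal_prefix a n2 ->
  (forall m, n1 < m -> m < n2 -> ~~ pal_prefix a m)%N ->
  det3 (palpt n0) (palpt n1) (palpt n2) = 0 -> (n2 - n1 <= n1 - n0)%N.
Proof.
move=> n01 n12 p0 p1 p2 gap.
have e1 := mkseq_pal_shift p0 p1 (ltnW n01).
have e2 := mkseq_pal_shift p1 p2 (ltnW n12).
have s0 := pal_cfprod_sym p0; have s1 := pal_cfprod_sym p1.
have s2 := pal_cfprod_sym p2.
rewrite /palpt; rewrite e2 cfprod_cat e1 cfprod_cat in s2 *.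
rewrite e1 cfprod_cat in s1.
have D0 : \det (cfprod (mkseq a n0)) != 0 by rewrite det_cfprod signr_eq0.
move=> /(det3_eq0_commute D0 s0 s1 s2); rewrite -!cfprod_cat => com.
apply: (@pal_prefix_commute _ a) => //.
have pos n := positive_mkseq a_pos n.
have /eqP : mkseq a (n2 - n1) ++ mkseq a (n1 - n0) ++ mkseq a (n1 - n0)
      ++ mkseq a n0 = mkseq a (n1 - n0) ++ mkseq a (n2 - n1) ++ mkseq a (n1 - n0) ++ mkseq a n0.
  apply: cfprod_inj com; last by rewrite !size_cat; lia.
    by rewrite /positive_word !all_cat; apply/and4P; split; exact: pos.
  by rewrite /positive_word !all_cat; apply/and4P; split; exact: pos.
rewrite catA [X in _ == X]catA eqseq_cat; last by rewrite !size_cat addnC.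
by case/andP => /eqP.
Qed.

Variable R : realType.
Local Notation q n := ((qcf a n)%:~R : R).
Local Notation xi := (cf_real R a).

Lemma norm_cf_real_le1 : `|xi| <= 1.
Proof.
have /andP[_] := cf_real_bounds a_pos R 0.
rewrite qcf0 pcf0 mul1r subr0 => h; apply: le_trans h _.
by rewrite invf_le1 ?qcf_gt0 // ler1z qcf_ge1.
Qed.

Lemma Lpt_palpt_le n : (0 < n)%N -> pal_prefix a n ->
  Lpt xi (palpt n) <= 2 / q n.
Proof.
case: n => // n _ pn.
have [ex1 ex2 ex3] : [/\ (palpt n.+1).1.1 = qcf a n.+1,
    (palpt n.+1).1.2 = pcf a n.+1 & (palpt n.+1).1.2 = qcf a n].
  rewrite /palpt /sympoint /=.
  by split=> //; [rewrite -pal_cfprod_sym|rewrite cfprod_mkseqS].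
have ex4 : (palpt n.+1).2 = pcf a n by rewrite /palpt /= cfprod_mkseqS.
have /andP[_ b1] := cf_real_bounds a_pos R n.
have /andP[_ b2] := cf_real_bounds a_pos R n.+1.
have q1 := qcf_gt0 a_pos R n.+1.
have {}b2 : `|q n.+1 * xi - (pcf a n.+1)%:~R| <= (q n.+1)^-1.
  by apply: le_trans b2 _; rewrite lef_pV2 ?posrE ?qcf_gt0 // ler_int qcf_leS.
have qV : 0 <= (q n.+1)^-1 by rewrite invr_ge0 ltW.
rewrite LptP ex1 ex4; apply/andP; split; first by rewrite ex2; lra.
(* Symmetry gives $p_{n+1} = q_n$, which expresses the error on $\xi^2$ through two successive
   convergents. *)
have -> : q n.+1 * xi ^+ 2 - (pcf a n)%:~R =
    xi * (q n.+1 * xi - (pcf a n.+1)%:~R) + (q n * xi - (pcf a n)%:~R).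
  by rewrite -ex2 ex3; ring.
apply: le_trans (ler_normD _ _) _; rewrite mulr_natl mulr2n lerD // normrM.
by rewrite -[leRHS]mul1r; apply: ler_pM => //; exact: norm_cf_real_le1.
Qed.

(** The first coordinate suffices: bounded partial quotients give $q_n + q_{n+1} \le (C+2) q_n$. *)
Lemma Lpt_palpt_ge C n : (forall i, a i <= C)%N -> pal_prefix a n ->
  (C.+2%:R * q n)^-1 <= Lpt xi (palpt n).
Proof.
move=> aC pn; have /andP[b _] := cf_real_bounds a_pos R n.
have q0 := qcf_gt0 a_pos R n; have q1 := qcf_gt0 a_pos R n.+1.
have := lexx (Lpt xi (palpt n)); rewrite LptP => /andP[h _].
apply: le_trans h; rewrite /palpt /sympoint /= -pal_cfprod_sym //.
apply: le_trans b; rewrite lef_pV2 ?posrE ?addr_gt0 ?mulr_gt0 //.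
have := qcfS_le a_pos n aC; rewrite -(ler_int R) intrM => h.
rewrite -[C.+2%:R]natr1 mulrDl mul1r addrC lerD2r; exact: h.
Qed.

End PalindromicPoints.

(** * Growth of the denominators *)

Section SubadditiveRecurrent.
Variables (R : realType) (f : nat -> nat -> R) (c : R) (N : nat -> nat).
Hypothesis f_ge0 : forall k l, 0 <= f k l.
Hypothesis f_sub : forall k l m, f k (l + m)%N <= f k l + f (k + l)%N m.
Hypothesis f_le : forall k l, f k l <= c * l.+1%:R.
Hypothesis N_ge : forall i, (i <= N i)%N.
Hypothesis N_rec : exists i0, forall i, (i0 <= i)%N -> forall k,
  exists2 t, (k <= t <= k + N i)%N & f t (N i) = f 0%N (N i).

(** Slopes that dominate all windows of some length; the infimum [A] is Fekete's limit of $\sup_k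
    f(k,l)/l$. *)
Let E : set R := [set a | exists2 l, (0 < l)%N & forall k, f k l <= a * l%:R].

Let E_lb : lbound E 0.
Proof.
move=> x [l l0 h]; have l0' : 0 < l%:R :> R by rewrite ltr0n.
by rewrite -(pmulr_lge0 _ l0') (le_trans (f_ge0 0%N l)).
Qed.

Let E_inf : has_inf E.
Proof.
split; last by exists 0.
by exists (c * 2); exists 1%N => // k; rewrite mulr1 f_le.
Qed.

Let A := inf E.

(** A window is cut into blocks of one length [l0] of slope close to [A]; the remainder costs a
    constant. *)
Lemma fekete_upper e : 0 < e ->
  exists C, forall k l, f k l <= (A + e) * l%:R + C.
Proof.
move=> e0; have [x [l0 l00 h] xA] := inf_adherent e0 E_inf.
have x0 : 0 <= x by apply: E_lb; exists l0.
have c0 : 0 <= c by have := le_trans (f_ge0 0%N 0%N) (f_le 0%N 0%N); rewrite mulr1.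
have mult n : forall k, f k (n * l0)%N <= x * (n * l0)%:R + c.
  elim: n => [|n IH] k.
    by have := f_le k 0; rewrite mul0n mulr0 add0r mulr1.
  rewrite mulSn; apply: le_trans (f_sub _ _ _) _.
  by rewrite natrD mulrDr -addrA lerD.
exists (c + c * l0%:R) => k l.
rewrite {1}(divn_eq l l0); apply: le_trans (f_sub _ _ _) _.
rewrite addrA lerD //; last first.
  apply: le_trans (f_le _ _) _; rewrite ler_wpM2l // ler_nat.
  by rewrite ltn_mod.
apply: le_trans (mult _ _) _; rewrite lerD2r.
apply: le_trans (_ : x * l%:R <= _); last by rewrite ler_wpM2r // ltW.
by rewrite ler_wpM2l // ler_nat leq_trunc_div.
Qed.

Lemma fekete_lower e l : 0 < e -> (0 < l)%N -> exists k, (A - e) * l%:R < f k l.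
Proof.
move=> e0 l0; apply: contrapT => no.
have : A <= A - e; last by rewrite lerBrDr gerDl leNgt e0.
apply: ge_inf; first by exists 0.
exists l => // k; rewrite leNgt; apply/negP => h; apply: no; by exists k.
Qed.

(* A window of length [2 * N i] contains the prefix of length [N i], so the
   value of the prefix cannot fall short of the maximal density [A]. *)
Lemma subadditive_recurrent_density : exists A : R, forall e : R, 0 < e ->
  exists i1, forall i, (i1 <= i)%N ->
    `|f 0%N (N i) - A * (N i)%:R| <= e * (N i)%:R.
Proof.
exists A => e e0; have e4 : 0 < e / 4 by lra.
have [C hC] := fekete_upper e4; have [i0 hi0] := N_rec.
have [n hn] : exists n : nat, (2 * `|C|) / (e / 4) < n.+1%:R.
  by exists (Num.truncn ((2 * `|C|) / (e / 4))); rewrite truncnS_gt.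
exists (maxn i0 n.+1) => i; rewrite geq_max => /andP[/hi0 rec ni].
have Nn : n.+1%:R <= (N i)%:R :> R by rewrite ler_nat (leq_trans ni).
have {}hn : 2 * `|C| <= (N i)%:R * (e / 4).
  by rewrite -ler_pdivrMr //; apply: le_trans Nn; exact: ltW.
have CC := ler_norm C; have C0 := normr_ge0 C.
set n' := (N i)%:R in Nn hn *.
have n'0 : 0 < n' by apply: lt_le_trans Nn; rewrite ltr0n.
have up := hC 0%N (N i).
rewrite -/n' mulrDl in up.
have [|k] := @fekete_lower (e / 4) (N i + N i)%N e4.
  by rewrite addn_gt0 (leq_trans _ (leq_trans ni (N_ge i))).
have [t /andP[kt tk] et] := rec k => low.
(* The pieces around the occurrence have total length [N i], so the upper bound leaves at least $A -
   3e/4$ per letter for the prefix, up to [2 * C]. *)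
have sub : f k (N i + N i)%N <=
    f k (t - k)%N + (f 0%N (N i) + f (t + N i)%N (k + N i - t)%N).
  have -> : (N i + N i = (t - k) + (N i + (k + N i - t)))%N by clear -kt tk; lia.
  apply: le_trans (f_sub _ _ _) _; rewrite lerD2l subnKC //.
  by apply: le_trans (f_sub _ _ _) _; rewrite et.
have h1 := hC k (t - k)%N.
have h2 := hC (t + N i)%N (k + N i - t)%N.
have e1 : (t - k)%:R + (k + N i - t)%:R = n' :> R.
  by rewrite -natrD; congr (_%:R); clear -kt tk; lia.
have e2 : (A + e / 4) * (t - k)%:R + (A + e / 4) * (k + N i - t)%:R =
    A * n' + e / 4 * n'.
  by rewrite -mulrDr e1 mulrDl.
move: low; rewrite natrD -/n' mulrBl !mulrDr => low.
rewrite ler_norml; apply/andP; split; lra.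
Qed.

End SubadditiveRecurrent.

(** * Denominators along palindromic prefixes *)

Section Growth.
Variables (R : realType) (a : nat -> nat) (C : nat) (N : nat -> nat).
Hypothesis a_pos : forall i, (0 < a i)%N.
Hypothesis a_le : forall i, (a i <= C)%N.
Hypothesis N_inc : forall i, (N i < N i.+1)%N.
Hypothesis N_pal : forall i, pal_prefix a (N i).
Hypothesis N_2 : exists i0, forall i, (i0 <= i)%N -> (N i.+1 <= 2 * N i)%N.

Local Notation q n := ((qcf a n)%:~R : R).

Let shift k := fun j => a (k + j)%N.
(** The factor 2 offsets the one in [cfprod00_cat_le] and makes [f] subadditive. *)
Let f k l : R := ln (2 * (qcf (shift k) l)%:~R).

Let shift_pos k i : (0 < shift k i)%N. Proof. exact: a_pos. Qed.

Let K_ge1 k l : 1 <= (qcf (shift k) l)%:~R :> R.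
Proof. by rewrite ler1z qcf_ge1. Qed.

Lemma log_qcf_density : exists2 A : R, 0 < A & forall e : R, 0 < e ->
  exists i1, forall i, (i1 <= i)%N ->
    `|ln (q (N i)) - A * (N i)%:R| <= e * (N i)%:R.
Proof.
have f_ge0 k l : 0 <= f k l by rewrite /f ln_ge0 //; have := K_ge1 k l; lra.
have f_sub k l m : f k (l + m)%N <= f k l + f (k + l)%N m.
  rewrite /f -lnM ?posrE ?mulr_gt0 ?qcf_gt0 //.
  rewrite ler_ln ?posrE ?mulr_gt0 ?qcf_gt0 //.
  have -> : qcf (shift k) (l + m) =
      cfprod (mkseq (shift k) l ++ mkseq (shift (k + l)) m) 0 0.
    rewrite /qcf /mkseq iotaD map_cat add0n -[X in iota X m]addn0 iotaDl -map_comp.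
    by congr (cfprod (_ ++ _) 0 0); apply: eq_map => j; rewrite /= /shift addnA.
  have := cfprod00_cat_le (positive_mkseq (shift_pos k) l)
    (positive_mkseq (shift_pos (k + l)) m).
  rewrite -(ler_int R) !intrM -/(qcf _ _) -/(qcf _ _); lra.
have f_le k l : f k l <= (ln 2 + ln C.+1%:R) * l.+1%:R.
  have C1 : 0 <= ln C.+1%:R :> R by rewrite ln_ge0 // ler1n.
  have l2 : 0 <= ln 2 :> R by rewrite ln_ge0 // ler1n.
  rewrite /f lnM ?posrE ?qcf_gt0 // mulrDl lerD //.
    by rewrite ler_peMr // ler1n.
  elim: l => [|l IH]; first by rewrite qcf0 ln1 mulr1.
  have := qcfS_le (shift_pos k) l (fun i => a_le (k + i)).
  rewrite -(ler_int R) intrM => h.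
  apply: (@le_trans _ _ (ln (C.+1%:R * (qcf (shift k) l)%:~R))).
    by rewrite ler_ln ?posrE ?mulr_gt0 ?qcf_gt0 ?ltr0n.
  rewrite lnM ?posrE ?qcf_gt0 ?ltr0n //.
  by rewrite -[l.+2%:R]natr1 mulrDr mulr1 addrC lerD2r.
have N_ge := increasing_ge_id N_inc.
have N_rec : exists i0, forall i, (i0 <= i)%N -> forall k,
    exists2 t, (k <= t <= k + N i)%N & f t (N i) = f 0%N (N i).
  have [i0 h] := N_2; exists i0 => i ii k.
  have [|t tk tw] := @pal_prefix_recurs _ a N N_inc N_pal i _ k.
    by move=> j ij; apply: h; apply: leq_trans ij.
  exists t => //; rewrite /f /qcf; congr (ln (2 * (cfprod _ 0 0)%:~R)).
  by apply/eq_in_map => x; rewrite mem_iota add0n => /andP[_ xN]; exact: tw.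
have [A hA] := subadditive_recurrent_density f_ge0 f_sub f_le N_ge N_rec.
have f0E n : f 0 n = ln 2 + ln (q n).
  by rewrite /f lnM ?posrE ?qcf_gt0.
have l2 : 0 < ln 2 :> R by rewrite ln_gt0 // ltr1n.
have low n : n%:R * ln 2 <= ln 2 + 2 * ln (q n).
  have := qcf_expo a_pos n; rewrite -(ler_int R) intrM !rmorphXn /= => h.
  have : ln (2 ^+ n) <= ln (2 * q n ^+ 2) :> R.
    by rewrite ler_ln ?posrE ?mulr_gt0 ?exprn_gt0 ?qcf_gt0.
  rewrite lnM ?posrE ?exprn_gt0 ?qcf_gt0 // !lnXn ?qcf_gt0 //.
  by rewrite -[ln 2 *+ n]mulr_natl -[ln (q n) *+ 2]mulr_natl.
exists A.
  (* The slope [ln 2 / 2] of [low] exceeds the allowed error [ln 2 / 8], so [A] is positive. *)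
  have [i1 h] := hA (ln 2 / 8) ltac:(lra).
  have := h (maxn i1 2) (leq_maxl _ _).
  have N2 : 2 <= (N (maxn i1 2))%:R :> R.
    by rewrite (ler_nat _ 2) (leq_trans _ (N_ge _)) // leq_maxr.
  have := low (N (maxn i1 2)); rewrite f0E ler_norml.
  set n := (N _)%:R in N2 *; set L := ln (q _) => h1 /andP[_ h2].
  have n0 : 0 < n by lra.
  have := ler_wpM2r (ltW l2) N2; rewrite -(pmulr_lgt0 _ n0); lra.
move=> e e0; have [i1 h] := hA (e / 2) ltac:(lra).
have [n hn] : exists n : nat, ln 2 / (e / 2) < n.+1%:R.
  by exists (Num.truncn (ln 2 / (e / 2))); rewrite truncnS_gt.
exists (maxn i1 n.+1) => i; rewrite geq_max => /andP[/h {}h ni].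
have Nn : n.+1%:R <= (N i)%:R :> R by rewrite ler_nat (leq_trans ni).
have {}hn : ln 2 <= (N i)%:R * (e / 2).
  by rewrite -ler_pdivrMr ?divr_gt0 //; apply: le_trans Nn; exact: ltW.
move: h; rewrite f0E !ler_norml => /andP[h1 h2]; apply/andP; split; lra.
Qed.

Lemma log_qcf_ratio (e : R) : 0 < e -> exists i1, forall i, (i1 <= i)%N ->
  `|ln (q (N i.+1)) - (N i.+1)%:R / (N i)%:R * ln (q (N i))| <= e * ln (q (N i)).
Proof.
move=> e0; have [A A0 hA] := log_qcf_density.
(* With $n$ the length [N i], the two density errors add up to at most $4e'n$; the first bound on
   [e'] gives $L \ge An/2$, and the second then $4e'n \le eL$. *)
pose e' := Num.min (A / 2) (e * A / 8).
have e'0 : 0 < e' by rewrite lt_min !divr_gt0 ?mulr_gt0.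
have e'1 : e' <= A / 2 by rewrite ge_min lexx.
have e'2 : e' <= e * A / 8 by rewrite ge_min lexx orbT.
have [i1 h] := hA _ e'0; have [i0 h2] := N_2.
exists (maxn (maxn i0 i1) 1) => i; rewrite !geq_max => /andP[/andP[ii0 ii1] i0'].
have := h2 _ ii0; rewrite -(ler_nat R) natrM.
have := h _ ii1; have := h _ (leqW ii1).
have n0 : 0 < (N i)%:R :> R.
  by rewrite ltr0n (leq_trans i0') ?(increasing_ge_id N_inc).
have := ler0n R (N i.+1).
set n := (N i)%:R in n0 *; set n1 := (N i.+1)%:R; set L1 := ln _; set L := ln _.
rewrite !ler_norml => n10 /andP[a1 a2] /andP[b1 b2] nn.
pose r := n1 / n.
have r2 : r <= 2 by rewrite ler_pdivrMr.
have r0 : 0 <= r by rewrite divr_ge0 // ltW.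
have n1E : n1 = r * n by rewrite /r divfK // gt_eqF.
rewrite -/r.
have LL : A / 2 * n <= L by have := ler_wpM2r (ltW n0) e'1; lra.
have eL : 4 * (e' * n) <= e * L.
  apply: le_trans (ler_wpM2l (ltW e0) LL).
  have -> : e * (A / 2 * n) = 4 * (e * A / 8 * n) by field.
  by rewrite ler_wpM2l // ler_wpM2r // ltW.
rewrite n1E in a1 a2.
have rn : r * (e' * n) <= 2 * (e' * n) by rewrite ler_wpM2r // mulr_ge0 ?ltW.
have := ler_wpM2l r0 b1; have := ler_wpM2l r0 b2.
by move=> *; apply/andP; split; lra.
Qed.

End Growth.

(** * The ratios of palindromic lengths *)

Lemma limn_esup_lt (R : realType) (u : nat -> R) (c : R) :
  (limn_esup (EFin \o u) < c%:E)%E ->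
  exists i0, forall i, (i0 <= i)%N -> u i < c.
Proof.
rewrite /limn_esup /limf_esup => /ereal_inf_lt[_ [V [i0 _ i0V] <-] lt].
exists i0 => i /i0V Vi; rewrite -lte_fin; apply: le_lt_trans lt.
by apply: ereal_sup_ubound; exists i.
Qed.

Lemma limn_esup_gt (R : realType) (u : nat -> R) (c : R) :
  (c%:E < limn_esup (EFin \o u))%E ->
  forall i0, exists2 i, (i0 <= i)%N & c < u i.
Proof.
rewrite /limn_esup /limf_esup => lt i0.
have : (c%:E < ereal_sup ((EFin \o u) @` [set i | (i0 <= i)%N]))%E.
  apply: lt_le_trans lt _; apply: ereal_inf_lbound.
  by exists [set i | (i0 <= i)%N] => //; exact: nbhs_infty_ge.
by move=> /ereal_sup_gt[_ [i /= ii <-]]; rewrite lte_fin => cu; exists i.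
Qed.

(** [delta] is infinite when palindromic prefixes are finitely many, so the hypothesis yields the
    whole sequence; its ratios exceed 1, so the upper limit is a real number. *)
Lemma delta_palindromic_lengths (R : realType) (T : eqType) (w : nat -> T) :
  (delta R w < 2%:E)%E ->
  exists (N : nat -> nat) (D : R),
    [/\ delta R w = D%:E, 1 <= D, D < 2 & (0 < N 0)%N] /\
    [/\ forall i, (N i < N i.+1)%N, forall i, pal_prefix w (N i),
      forall i m, (N i < m)%N -> (m < N i.+1)%N -> ~~ pal_prefix w m,
      forall e : R, 0 < e -> exists i0, forall i, (i0 <= i)%N ->
        (N i.+1)%:R / (N i)%:R <= D + e &
      forall e : R, 0 < e -> forall i0, exists2 i, (i0 <= i)%N &
        D - e <= (N i.+1)%:R / (N i)%:R].
Proof.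
rewrite /delta; case: pselect => // H lt2.
pose N := pal_length H.
have NS i : N i.+1 = ex_minn (H (N i)) by [].
have N0 : (0 < N 0)%N.
  by rewrite /N /pal_length /=; case: ex_minnP => m /andP[].
have N_inc i : (N i < N i.+1)%N.
  by rewrite NS; case: ex_minnP => m /andP[].
have N_pal i : pal_prefix w (N i).
  by case: i => [|i]; rewrite ?NS /N /pal_length /=; case: ex_minnP => m /andP[].
have N_gap i m : (N i < m)%N -> (m < N i.+1)%N -> ~~ pal_prefix w m.
  rewrite NS; case: ex_minnP => n _ mn im mn'; apply/negP => pm.
  by have := mn m; rewrite im pm => /(_ isT); rewrite leqNgt mn'.
have Npos i : (0 < N i)%N by case: i => // i; apply: leq_ltn_trans (N_inc i).
pose u i : R := (N i.+1)%:R / (N i)%:R.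
have u1 i : 1 < u i.
  by rewrite /u ltr_pdivlMr ?ltr0n // mul1r ltr_nat.
move: lt2; rewrite -/N.
have -> : (fun i => ((N i.+1)%:R / (N i)%:R)%:E) = EFin \o u by [].
set l := limn_esup _ => lt2.
have ge1 : (1%:E <= l)%E.
  rewrite leNgt; apply/negP => /limn_esup_lt[i0 /(_ i0 (leqnn _))].
  by rewrite ltNge ltW.
have [D lD] : exists D, l = D%:E.
  by move: lt2 ge1; case: l => [D| |] //; exists D.
exists N, D; rewrite lD; move: ge1 lt2; rewrite lD lee_fin lte_fin => D1 D2.
split; first by split.
split=> // e e0.
  have [|i0 h] := @limn_esup_lt _ u (D + e); first by rewrite -/l lD lte_fin ltrDl.
  by exists i0 => i /h /ltW.
move=> i0; have [|i ii h] := @limn_esup_gt _ u (D - e) _ i0.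
  by rewrite -/l lD lte_fin gtrBl.
by exists i => //; exact: ltW.
Qed.

Lemma pal_prefix_comp (T U : eqType) (w : nat -> T) (g : T -> U) n :
  injective g -> pal_prefix (fun i => g (w i)) n = pal_prefix w n.
Proof.
move=> gi; rewrite /pal_prefix.
have -> : mkseq (fun i => g (w i)) n = map g (mkseq w n) by rewrite -map_comp.
by rewrite -map_rev inj_eq //; exact: inj_map.
Qed.

(** * Exponents of approximation *)

Section Exponents.
Variables (R : realType) (a : nat -> nat) (C : nat) (N : nat -> nat) (D : R).
Hypothesis a_pos : forall i, (0 < a i)%N.
Hypothesis a_le : forall i, (a i <= C)%N.
Hypothesis a_aper : ~ ultimately_periodic a.
Hypothesis N0_gt0 : (0 < N 0)%N.
Hypothesis N_inc : forall i, (N i < N i.+1)%N.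
Hypothesis N_pal : forall i, pal_prefix a (N i).
Hypothesis N_gap : forall i m, (N i < m)%N -> (m < N i.+1)%N -> ~~ pal_prefix a m.
Hypothesis D_ge1 : 1 <= D.
Hypothesis D_lt2 : D < 2.
Hypothesis D_ub : forall e : R, 0 < e -> exists i0, forall i, (i0 <= i)%N ->
  (N i.+1)%:R / (N i)%:R <= D + e.
Hypothesis D_lb : forall e : R, 0 < e -> forall i0, exists2 i, (i0 <= i)%N &
  D - e <= (N i.+1)%:R / (N i)%:R.

Local Notation xi := (cf_real R a).
Let pt i := palpt a (N i).
Let Y i : R := (qcf a (N i))%:~R.
Let lam i : R := ln (Y i).

Let N_gt0 i : (0 < N i)%N.
Proof. by case: i => // i; apply: leq_ltn_trans (N_inc i). Qed.

Let Y_gt0 i : 0 < Y i. Proof. exact: qcf_gt0. Qed.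
Let Y_ge1 i : 1 <= Y i. Proof. by rewrite /Y ler1z qcf_ge1. Qed.
Let Y_mono i j : (i <= j)%N -> Y i <= Y j.
Proof.
by move=> ij; rewrite /Y ler_int; apply: qcf_mono => //; exact: increasing_leq.
Qed.
Let lam_ge0 i : 0 <= lam i. Proof. exact: ln_ge0. Qed.
Let lamK i : expR (lam i) = Y i. Proof. by rewrite /lam lnK ?posrE. Qed.

Let norm_pt i : `|(pt i).1.1%:~R| = Y i.
Proof. by rewrite -[_%:~R]/(Y i) gtr0_norm. Qed.

Let pt_Lle i : Lpt xi (pt i) <= 2 / Y i.
Proof. exact: Lpt_palpt_le. Qed.

Let N_2 : exists i0, forall i, (i0 <= i)%N -> (N i.+1 <= 2 * N i)%N.
Proof.
have [|i0 h] := D_ub (e := 2 - D); first by rewrite subr_gt0.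
exists i0 => i /h; rewrite subrKC ler_pdivrMr ?ltr0n //.
by rewrite -natrM ler_nat.
Qed.

Let lam_ratio := @log_qcf_ratio R a C N a_pos a_le N_inc N_pal N_2.

Lemma lam_unbounded M : exists i0, forall i, (i0 <= i)%N -> M <= lam i.
Proof.
have [A A0 h] := @log_qcf_density R a C N a_pos a_le N_inc N_pal N_2.
have [i1 {}h] := h (A / 2) ltac:(lra).
have [n hn] : exists n : nat, M / (A / 2) < n.+1%:R.
  by exists (Num.truncn (M / (A / 2))); rewrite truncnS_gt.
exists (maxn i1 n.+1) => i; rewrite geq_max => /andP[/h {}h ni].
have Nn : n.+1%:R <= (N i)%:R :> R.
  by rewrite ler_nat (leq_trans ni) ?(increasing_ge_id N_inc).
move: hn; rewrite ltr_pdivrMr ?divr_gt0 // => hn.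
have A2 : 0 <= A / 2 by lra.
have An := ler_wpM2r A2 Nn.
move: h; rewrite ler_norml -/(Y i) -/(lam i) => /andP[h _].
lra.
Qed.

Lemma lam_ub (e : R) : 0 < e ->
  exists i0, forall i, (i0 <= i)%N -> lam i.+1 <= (D + e) * lam i.
Proof.
move=> e0; have e2 : 0 < e / 2 by lra.
have [i0 h0] := D_ub e2; have [i1 h1] := lam_ratio e2.
exists (maxn i0 i1) => i; rewrite geq_max => /andP[/h0 {}h0 /h1].
rewrite ler_norml -/(Y i) -/(Y i.+1) -/(lam i) -/(lam i.+1) => /andP[_ {}h1].
have := ler_wpM2r (lam_ge0 i) h0; lra.
Qed.

(** * Indices with three independent points *)

Let independent i := det3 (pt i) (pt i.+1) (pt i.+2) != 0.

Lemma dependent_concave i : ~~ independent i ->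
  (N i.+2 - N i.+1 <= N i.+1 - N i)%N.
Proof.
by rewrite negbK => /eqP; apply: palpt_dependent => // m; exact: N_gap.
Qed.

(** Aperiodicity provides independent indices. From an index with a large ratio one descends to the
    nearest independent one: past dependent indices the ratio can only grow on the way down. *)
Lemma independent_lb (e : R) : 0 < e -> forall i0, exists2 i, (i0 <= i)%N &
  independent i /\ D - e <= (N i.+2)%:R / (N i.+1)%:R.
Proof.
move=> e0 i0.
have [g gi ig] : exists2 g, (i0 <= g)%N & independent g.
  apply: contrapT => no; apply: a_aper.
  apply: (@concave_ultimately_periodic _ a N N_inc N_pal i0) => i ii.
  by apply: dependent_concave; apply/negP => gi; apply: no; exists i.
(* Starting from [g.+1] makes the descent stop at the independent index [g] at the latest. *)
have [[|j] gj hj] := D_lb e0 g.+1; first by [].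
rewrite ltnS in gj.
have [i gi' [ii hi]] : exists2 i, (g <= i)%N & independent i /\
    (N j.+2)%:R / (N j.+1)%:R <= (N i.+2)%:R / (N i.+1)%:R :> R.
  elim: j gj {hj} => [|j IH] gj.
    by exists 0%N => //; split=> //; move: gj ig; rewrite leqn0 => /eqP ->.
  have [ij|/dependent_concave nj] := boolP (independent j.+1).
    by exists j.+1.
  move: gj; rewrite leq_eqVlt ltnS => /orP[/eqP gj|/IH[i gi' [ii hi]]].
    by exists g => //; split=> //; rewrite gj.
  exists i => //; split=> //; apply: le_trans hi.
  rewrite ler_pdivrMr ?ltr0n // mulrAC ler_pdivlMr ?ltr0n //.
  rewrite -!natrM ler_nat.
  have := N_inc j; have := N_inc j.+1; have := N_inc j.+2; nia.
by exists i; [exact: leq_trans gi'|split=> //; exact: le_trans hi].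
Qed.

Lemma lam_independent_lb (e : R) : 0 < e -> forall i0,
  exists2 i, (i0 <= i)%N & independent i /\ (D - e) * lam i.+1 <= lam i.+2.
Proof.
move=> e0 i0; have e2 : 0 < e / 2 by lra.
have [i1 h1] := lam_ratio e2.
have [i] := independent_lb e2 (maxn i0 i1).
rewrite geq_max => /andP[ii0 /leqW /h1]; rewrite ler_norml => /andP[{}h1 _] [gi h].
exists i => //; split=> //; move: h1.
rewrite -/(Y i.+2) -/(Y i.+1) -/(lam i.+1) -/(lam i.+2).
have := ler_wpM2r (lam_ge0 i.+1) h; lra.
Qed.

(** For $Y_i \le B < Y_{i+1}$ the point [pt i] serves: half of the gap [b - D] pays for the growth
    of [lam], the other half for the factor 2 in $L \le 2/Y_i$; the condition on [eps] holds once
    $Y_i^\varepsilon \ge 2$. *)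
Lemma beta_exponent_gt (eps b : R) : 0 < eps -> D < b -> beta_exponent eps xi b.
Proof.
move=> eps0 Db; have b0 : 0 < b by apply: lt_trans Db; apply: lt_le_trans D_ge1.
split=> //.
have [i1 h1] := lam_ub (e := (b - D) / 2) ltac:(lra).
have r0 : 0 < (b - D) / 2 by lra.
have [i2 h2] := lam_unbounded (b * ln 2 / ((b - D) / 2)).
have [i3 h3] := lam_unbounded (ln 2 / eps).
pose i0 := maxn i1 (maxn i2 i3).
exists (Y i0); split=> [|B YB]; first exact: num_real.
have B0 : 0 < B by apply: lt_trans YB.
have [i ii /andP[YiB BYi]] : exists2 i, (i0 <= i)%N & Y i <= B < Y i.+1.
  have H k : B < Y (i0 + k)%N -> exists2 i, (i0 <= i)%N & Y i <= B < Y i.+1.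
    elim: k => [|k IH]; first by rewrite addn0 => /(lt_trans YB); rewrite ltxx.
    rewrite addnS => h; have [|/IH //] := leP (Y (i0 + k)%N) B.
    by move=> h'; exists (i0 + k)%N; rewrite ?leq_addr // h' h.
  have [j hj] := lam_unbounded (ln B + 1).
  apply: (H (j + 0)%N); rewrite addn0 -(lnK (x := B)) ?posrE // -lamK ltr_expR.
  by apply: lt_le_trans (hj _ (leq_addl _ _)); rewrite ltrDl.
exists (pt i).1.1, (pt i).1.2, (pt i).2.
rewrite norm_pt; split=> //; rewrite le_min.
move: ii; rewrite /i0 !geq_max => /and3P[/h1 {}h1 /h2 {}h2 /h3 {}h3].
have Y2 : 2 / Y i = expR (ln 2 - lam i).
  by rewrite expRD expRN lamK lnK ?posrE.
have lnB : ln B <= lam i.+1 by rewrite /lam ler_ln ?posrE // ltW.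
apply/andP; split; apply: le_trans (pt_Lle i) _.
  rewrite /powR gt_eqF // Y2 ler_expR.
  move: h2; rewrite ler_pdivrMr // => h2.
  rewrite mulNr lerNr opprB [_ * ln B]mulrC ler_pdivrMr //.
  lra.
rewrite /powR gt_eqF // Y2 ler_expR -/(lam i).
move: h3; rewrite ler_pdivrMr //; lra.
Qed.

(** * Exclusion of better approximations *)

Lemma det3_pt_eq0 x j k : (j <= k)%N ->
  8 * (`|x.1.1%:~R| / (Y j * Y k)) + 8 * (Lpt xi x * Y k / Y j) < 1 ->
  det3 x (pt j) (pt k) = 0.
Proof.
move=> jk h; apply: (det3_eq0 (xi := xi)); apply: le_lt_trans h.
have Lj := pt_Lle j; have Lk := pt_Lle k.
have [[Lj0 Lk0] Lx0] := (Lpt_ge0 xi (pt j), Lpt_ge0 xi (pt k), Lpt_ge0 xi x).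
rewrite !norm_pt; set X := `|_|; have X0 : 0 <= X by exact: normr_ge0.
have Yjk := Y_mono jk; have yj := Y_gt0 j; have yk := Y_gt0 k.
set L := Lpt xi x in Lx0 *; set Lj' := Lpt _ _ in Lj Lj0 *.
set Lk' := Lpt _ _ in Lk Lk0 *.
have t1 : X * Lj' * Lk' <= 4 * (X / (Y j * Y k)).
  have -> : 4 * (X / (Y j * Y k)) = X * (2 / Y j) * (2 / Y k).
    by field; rewrite !gt_eqF.
  by rewrite ler_pM // ?mulr_ge0 // ler_wpM2l.
have t2 : Y j * L * Lk' <= 2 * (L * Y k / Y j).
  have -> : 2 * (L * Y k / Y j) = Y k * L * (2 / Y j) by field; rewrite gt_eqF.
  rewrite ler_pM ?mulr_ge0 ?ler_wpM2r //; first exact: ltW.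
  apply: le_trans Lk _; rewrite ler_wpM2l // lef_pV2 //.
have t3 : Y k * L * Lj' <= 2 * (L * Y k / Y j).
  have -> : 2 * (L * Y k / Y j) = Y k * L * (2 / Y j) by field; rewrite gt_eqF.
  by rewrite ler_pM ?mulr_ge0 //; exact: ltW.
lra.
Qed.

(** [x] lies in the plane of the last two points; the size of its first coordinate decides which
    plane through [pt i] also contains it, hence whether it is a multiple of [pt i.+1] or of
    [pt i.+2]. The constants 16 and 32 bring each term of [det3_pt_eq0] down to 1/4. *)
Lemma no_point_before i x : independent i -> 16 <= Y i ->
  Y i.+2 <= Y i.+1 ^+ 2 -> 1 <= `|x.1.1%:~R : R| -> `|x.1.1%:~R| <= Y i.+2 / 2 ->
  32 * C.+2%:R * Y i.+1 * Lpt xi x <= 1 ->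
  (Y i * Y i.+1 / 32 < `|x.1.1%:~R| -> 32 * (Lpt xi x * Y i.+2 / Y i) <= 1) ->
  False.
Proof.
move=> ind Y16 Ysq X1 XY2 Lx small.
have Y01 := Y_mono (leqnSn i); have Y12 := Y_mono (leqnSn i.+1).
have y0 := Y_gt0 i; have y1 := Y_gt0 i.+1; have y2 := Y_gt0 i.+2.
have C2 : 1 <= C.+2%:R :> R by rewrite ler1n.
have Lx0 := Lpt_ge0 xi x; set L := Lpt xi x in Lx small Lx0.
set X := `|_| in X1 XY2 small.
have LY : 32 * (L * Y i.+1) <= 1.
  apply: le_trans Lx.
  have -> : 32 * C.+2%:R * Y i.+1 * L = C.+2%:R * (32 * (L * Y i.+1)) by ring.
  by rewrite ler_peMl // !mulr_ge0 // ltW.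
have X0 : x.1.1%:~R != 0 :> R.
  by rewrite -normr_eq0 gt_eqF //; apply: lt_le_trans X1.
have D12 : det3 x (pt i.+1) (pt i.+2) = 0.
  apply: det3_pt_eq0 => //; rewrite -/X -/L.
  have h1 : X / (Y i.+1 * Y i.+2) <= 1 / 32.
    rewrite ler_pdivrMr ?mulr_gt0 //.
    have := ler_wpM2r (ltW y2) (le_trans Y16 Y01); lra.
  have h2 : L * Y i.+2 / Y i.+1 <= L * Y i.+1.
    by rewrite ler_pdivrMr // -mulrA ler_wpM2l // -expr2.
  lra.
have [X01|/small sm] := leP X (Y i * Y i.+1 / 32).
  have D01 : det3 x (pt i) (pt i.+1) = 0.
    apply: det3_pt_eq0 => //; rewrite -/X -/L.
    have h1 : X / (Y i * Y i.+1) <= 1 / 32.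
      by rewrite ler_pdivrMr ?mulr_gt0 //; lra.
    have h2 : L * Y i.+1 / Y i <= L * Y i.+1.
      rewrite ler_pdivrMr // ler_peMr // ?mulr_ge0 // ltW //.
    lra.
  have [k xE] := det3_proportional ind (palpt_unimodular (N_pal i.+1)) D12 D01.
  have k1 : 1 <= `|k%:~R : R|.
    rewrite -intr_norm ler1z; move: X0; rewrite xE /= intrM mulf_eq0 negb_or.
    by rewrite intr_eq0 -gtz0_ge1 normr_gt0 => /andP[].
  have := Lpt_palpt_ge a_pos R a_le (N_pal i.+1).
  have LE : L = `|k%:~R| * Lpt xi (pt i.+1) by rewrite /L xE Lpt_scale.
  have := ler_peMl (Lpt_ge0 xi (pt i.+1)) k1; rewrite -LE => h1 h2.
  have {h1 h2} := le_trans h2 h1.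
  rewrite -/(Y i.+1) -[X in X <= _]mul1r ler_pdivrMr ?mulr_gt0 //; lra.
have D02 : det3 x (pt i) (pt i.+2) = 0.
  apply: det3_pt_eq0; rewrite -/X -/L; first by rewrite (leq_trans (leqnSn i)).
  have h1 : X / (Y i * Y i.+2) <= 1 / 32.
    rewrite ler_pdivrMr ?mulr_gt0 //.
    have := ler_wpM2r (ltW y2) Y16; lra.
  lra.
(* The last two points are exchanged so that [pt i.+2] is the middle argument of
   [det3_proportional]. *)
have ind' : det3 (pt i) (pt i.+2) (pt i.+1) != 0.
  have -> : det3 (pt i) (pt i.+2) (pt i.+1) = - det3 (pt i) (pt i.+1) (pt i.+2).
    by rewrite /det3; ring.
  by rewrite oppr_eq0.
have D21 : det3 x (pt i.+2) (pt i.+1) = 0.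
  have -> : det3 x (pt i.+2) (pt i.+1) = - det3 x (pt i.+1) (pt i.+2).
    by rewrite /det3; ring.
  by rewrite D12 oppr0.
have [k xE] := det3_proportional ind' (palpt_unimodular (N_pal i.+2)) D21 D02.
have k1 : 1 <= `|k%:~R : R|.
  rewrite -intr_norm ler1z; move: X0; rewrite xE /= intrM mulf_eq0 negb_or.
  by rewrite intr_eq0 -gtz0_ge1 normr_gt0 => /andP[].
have XE : X = `|k%:~R| * Y i.+2.
  by rewrite /X xE /= intrM normrM norm_pt.
have := ler_wpM2r (ltW y2) k1; lra.
Qed.

Lemma beta_exponent_ge : exists2 eps : R, 0 < eps < 1 &
  forall b, beta_exponent eps xi b -> D <= b.
Proof.
have [D' [DD' D'1 D'2]] : exists D' : R, [/\ D < D', 3 / 2 <= D' & D' < 2].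
  exists ((D + 2) / 2); have := D_ge1; have := D_lt2 => d1 d2; split; lra.
(* This is $2 - D'(D' - 1)$. As [lam] grows by a factor at most [D'] per step, $\lambda_{i+2} -
   \lambda_{i+1} - 2\lambda_i \le -\kappa\lambda_i$. *)
pose kap := (2 - D') * (1 + D').
have kap0 : 0 < kap by rewrite mulr_gt0; lra.
have kap3 : kap <= 3 / 2 by rewrite /kap; nra.
(* Since $\lambda_{i+1} \le 2\lambda_i$, this [eps] costs at most $\kappa(\lambda_i +
   \lambda_{i+1})/6 \le \kappa\lambda_i/2$, half of the gain. *)
exists (kap / 6); first by apply/andP; split; lra.
move=> b [b0 [M [_ hM]]]; rewrite leNgt; apply/negP => bD.
have [i1 h1] := lam_ub (e := D' - D) ltac:(lra).
have l2 : 0 <= ln 2 :> R by rewrite ln_ge0 // ler1n.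
pose K : R := ln (32 * C.+2%:R).
have g0 : 0 < (D - b) / 2 by lra.
have [i2 h2] := lam_unbounded (((b * K) + ln 2) / ((D - b) / 2)).
have [i3 h3] := lam_unbounded (ln 16).
have [i4 h4] := lam_unbounded (ln (2 * (`|M| + 1))).
have [i5 h5] := lam_unbounded (2 * ln 32 / (kap / 2)).
have [i] := lam_independent_lb g0 (maxn i1 (maxn i2 (maxn i3 (maxn i4 i5)))).
rewrite !geq_max => /and5P[ii1 ii2 ii3 ii4 ii5] [ind lb].
have ub0 := h1 _ ii1; have ub1 := h1 _ (leqW ii1); rewrite subrKC in ub0 ub1.
have {}h2 := h2 _ (leqW ii2); have {}h3 := h3 _ ii3.
have {}h4 := h4 _ (leqW (leqW ii4)); have {}h5 := h5 _ ii5.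
(* The value $B = Y_{i+2}/2$ is beyond the threshold [M] of the exponent condition. *)
have YM : M < Y i.+2 / 2.
  have : 2 * (`|M| + 1) <= Y i.+2.
    by rewrite -lamK -[leLHS]lnK ?ler_expR // posrE; have := normr_ge0 M; lra.
  have := ler_norm M; lra.
have [x0 [x1 [x2 [X1 XB]]]] := hM _ YM.
rewrite le_min => /andP[Lb Leps].
have lam0 := lam_ge0 i; have lam1 := lam_ge0 i.+1.
have y0 := Y_gt0 i; have y1 := Y_gt0 i.+1; have y2 := Y_gt0 i.+2.
apply: (@no_point_before i (x0, x1, x2)) => //.
- by rewrite -lamK -[leLHS]lnK ?ler_expR // posrE.
- rewrite -!lamK -expRM_natl ler_expR; nra.
(* The choice of [i] gives $\ln B \ge b(\lambda_{i+1} + K)$, so $B^{-1/b} \le e^{-K}/Y_{i+1}$. *)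
- have lnB : ln (Y i.+2 / 2) = lam i.+2 - ln 2 by rewrite ln_div ?posrE.
  have : Lpt xi (x0, x1, x2) <= expR (- (lam i.+1 + K)).
    apply: le_trans Lb _; rewrite /powR gt_eqF ?divr_gt0 // ler_expR lnB.
    rewrite mulNr lerNl opprK mulrC ler_pdivlMr //.
    move: h2; rewrite ler_pdivrMr //; lra.
  have K0 : 0 < 32 * C.+2%:R :> R by rewrite mulr_gt0 // ltr0n.
  rewrite expRN expRD lamK /K lnK ?posrE // [Y _ * _]mulrC => h.
  by rewrite mulrC -ler_pdivlMr ?mulr_gt0 // div1r.
- move=> /= XY; rewrite -/(approx_L _ _ _ _) in Leps.
  have l32 : 0 < ln 32 :> R by rewrite ln_gt0 // ltr1n.
  have lnX : lam i + lam i.+1 - ln 32 <= ln `|x0%:~R|.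
    rewrite -lnM ?posrE // -ln_div ?posrE ?mulr_gt0 //.
    rewrite ler_ln ?posrE ?divr_gt0 ?mulr_gt0 //.
      exact: ltW.
    by apply: lt_le_trans X1.
  have : Lpt xi (x0, x1, x2) <= expR ((kap / 6 - 1) * (lam i + lam i.+1 - ln 32)).
    apply: le_trans Leps _; rewrite /powR gt_eqF ?ler_expR; last first.
      by apply: lt_le_trans X1.
    by apply: ler_wnM2l => //; lra.
  move=> /(ler_wpM2r (ltW y2)) /(ler_wpM2r (ltW (_ : 0 < (Y i)^-1))).
  rewrite invr_gt0 => /(_ y0) h.
  have : Lpt xi (x0, x1, x2) * Y i.+2 / Y i <= expR (- ln 32).
    apply: le_trans h _; rewrite -!lamK -expRN -!expRD ler_expR.
    move: h5; rewrite ler_pdivrMr ?divr_gt0 // => h5.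
    have e1 : lam i.+2 - lam i.+1 <= (D' - 1) * lam i.+1 by lra.
    have e2 : (D' - 1) * lam i.+1 <= (D' - 1) * (D' * lam i).
      by rewrite ler_wpM2l //; lra.
    have e3 : kap * lam i.+1 <= kap * (2 * lam i).
      rewrite ler_wpM2l //; first exact: ltW.
      by apply: le_trans ub0 _; rewrite ler_wpM2r //; lra.
    have e4 : (D' - 1) * (D' * lam i) - 2 * lam i = - (kap * lam i).
      by rewrite /kap; ring.
    have e5 : 0 <= kap * ln 32 by rewrite mulr_ge0 // ltW.
    lra.
  rewrite expRN lnK ?posrE // => {}h.
  by rewrite mulrC -ler_pdivlMr // div1r.
Qed.

(** The upper bound holds for every [eps]; as [beta0] is a supremum, a single [eps] suffices for the
    lower one. *)
Lemma beta0_palindromic : beta0 xi = D%:E.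
Proof.
apply/eqP; rewrite eq_le; apply/andP; split.
  apply: ge_ereal_sup => _ [eps /= /andP[eps0 _] <-].
  apply/lee_addgt0Pr => e e0; apply: ereal_inf_lbound.
  by exists (D + e) => //; apply: beta_exponent_gt => //; rewrite ltrDl.
have [eps heps h] := beta_exponent_ge.
apply: (@le_trans _ _ (beta eps xi)); last first.
  by apply: ereal_sup_ubound; exists eps.
by apply: le_ereal_inf_tmp => _ [b /h Db <-]; rewrite lee_fin.
Qed.

End Exponents.

Theorem theorem5p4 (R : realType) (A : finType) (w : nat -> A)
    (w_aper : ~ ultimately_periodic w)
    (delta_lt2 : (delta R w < 2%:E)%E)
    (phi : A -> nat) (phi_pos : forall a : A, (0 < phi a)%N)
    (phi_inj : injective phi) :
  beta0 (cf_real R (fun i => phi (w i))) = delta R w.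
Proof.
have [N [D [[-> D1 D2 N0] [N_inc N_pal N_gap D_ub D_lb]]]] :=
  delta_palindromic_lengths delta_lt2.
(* Finiteness of the alphabet bounds the partial quotients; injectivity of [phi] carries
   aperiodicity and palindromic prefixes over to them. *)
apply: (@beta0_palindromic _ _ (\max_(x : A) phi x) N) => //.
- by move=> i; exact: leq_bigmax.
- move=> [n [p [p0 per]]]; apply: w_aper; exists n, p; split=> // m nm.
  exact/phi_inj/per.
- by move=> i; rewrite pal_prefix_comp.
- by move=> i m im mi; rewrite pal_prefix_comp //; exact: N_gap im mi.
Qed.
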